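(* Let $\mathbb A$ be a Weil algebra of nilpotency index $N$ and $U\subset\mathbb R^p$ open. Let $P:\mathbb R^s\to\mathbb R^r$ be a polynomial map and let $f_1,\dots,f_s\in C^N(U,\mathbb R)$. If $$P(f_1(x),\dots,f_s(x))=0\qquad(x\in U),$$ then $$P(J_{\mathbb A}f_1(X),\dots,J_{\mathbb A}f_s(X))=0\qquad(X\in U^{\mathbb A}),$$ where $P$ is evaluated on $\mathbb A^s$ as a polynomial with real coefficients. More generally, let $f=(f_1,\dots,f_s)$, let $V\subset\mathbb R^s$ be open with $f(U)\subset V$, and let $h\in C^N(V,\mathbb R^r)$ be a fixed single-valued map. Then $$h\circ f=0\ \text{ on } U\quad\Longrightarrow\quad (J_{\mathbb A}h)\circ(J_{\mathbb A}f)=J_{\mathbb A}(h\circ f)=0\ \text{ on } U^{\mathbb A}.$$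
   Context: A Weil algebra is a finite-dimensional, commutative, associative real algebra with unit of the form $\mathbb A=\mathbb R 1_{\mathbb A}\oplus\mathfrak m$, where $\mathfrak m$ is the unique maximal ideal and $\mathfrak m^{N+1}=0$, $\mathfrak m^N\neq 0$; $N$ is its nilpotency index. The scalar-part projection $\pi:\mathbb A\to\mathbb R$ is the algebra morphism with kernel $\mathfrak m$; it acts componentwise on $\mathbb A^p$. For $U\subset\mathbb R^p$ open, $U^{\mathbb A}=\{X\in\mathbb A^p:\pi(X)\in U\}$. Finite Weil prolongation: for $f\in C^N(U,\mathbb R^q)$, $x\in U$, $H=(H_1,\dots,H_p)\in\mathfrak m^p=\mathfrak m\times\cdots\times\mathfrak m$, $$(J_{\mathbb A}f)(x+H)=\sum_{|\alpha|\le N}\frac1{\alpha!}(\partial^\alpha f)(x)H^\alpha\in\mathbb A^q .$$ *)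

(* Defs.v *)
From HB Require Import structures.
From mathcomp Require Import all_boot all_order all_algebra falgebra.
From mathcomp Require Import all_classical all_reals all_analysis.
From mathcomp Require mpoly.
(* The notations of [mpoly] clash with those of mathcomp-analysis. *)
Import -(notations) mpoly.

Set Implicit Arguments.
Unset Strict Implicit.
Unset Printing Implicit Defensive.

Import Order.TTheory GRing.Theory Num.Theory.
Import numFieldNormedType.Exports.

Local Open Scope classical_set_scope.
Local Open Scope ring_scope.

Section Ideals.
Context {K : fieldType} {A : falgType K}.
Implicit Types I J : {vspace A}.

(* In a unital [K]-algebra every ideal is a [K]-subspace, so that ideals of a
   commutative [A] are exactly the subspaces stable under multiplication. *)
Definition ideal I : Prop := ({:A} * I <= I)%VS.

Definition maximal_ideal I : Prop :=
  [/\ ideal I, I <> fullv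
    & forall J, ideal J -> (I <= J)%VS -> J = I \/ J = fullv].

End Ideals.

(* [weilAlgType R N]: Weil algebras over [R] of nilpotency index [N].  In the
   last axiom the power is [1%VS] (the line spanned by [1]) when [N = 0]. *)
HB.mixin Record isWeilAlgebra (R : realType) (N : nat) A
    of Falgebra R A & GRing.PzRing_hasCommutativeMul A := {
  weil_ideal : {vspace A};
  weil_ideal_max : maximal_ideal weil_ideal;
  weil_ideal_unique :
    forall I : {vspace A}, maximal_ideal I -> I = weil_ideal;
  weil_split : (1 + weil_ideal)%VS = fullv;
  weil_direct : (1 :&: weil_ideal)%VS = 0%VS;
  weil_nil : (weil_ideal ^+ N.+1)%VS = 0%VS;
  weil_nonnil : (weil_ideal ^+ N)%VS <> 0%VS
}.

#[short(type="weilAlgType")]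
HB.structure Definition WeilAlgebra (R : realType) (N : nat) :=
  { A of isWeilAlgebra R N A & Falgebra R A
       & GRing.PzRing_hasCommutativeMul A }.

Section ScalarPart.
Context {R : realType} {N : nat} {A : weilAlgType R N}.
Implicit Types a b : A.
Local Notation m := (weil_ideal : {vspace A}).

Definition scalar_part a : R :=
  coord [tuple (1 : A)] ord0 (daddv_pi 1%VS weil_ideal a).

Lemma scalar_part_split a : a - (scalar_part a)%:A \in m.
Proof.
have dir : (1 :&: m)%VS = 0%VS by exact: weil_direct.
have aV : a \in (1 + m)%VS by rewrite weil_split memvf.
have dcap : (m :&: 1)%VS = 0%VS by rewrite capvC.
have -> : (scalar_part a)%:A = daddv_pi 1%VS m a.
  have : daddv_pi 1%VS m a \in <<[tuple (1%R : A)]>>%VS.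
    by rewrite span_seq1 memv_pi.
  by rewrite /scalar_part => /coord_span {2}->; rewrite big_ord1.
rewrite -{1}(daddv_pi_add dir aV) addrAC subrr add0r.
exact: memv_pi.
Qed.

Lemma scalar_part_unique a (c : R) :
  a - c%:A \in m -> scalar_part a = c.
Proof.
move=> ac; apply/eqP; rewrite -subr_eq0.
have : (scalar_part a - c)%:A \in m.
  have -> : (scalar_part a - c)%:A
            = (a - c%:A) - (a - (scalar_part a)%:A) :> A.
    by rewrite scalerBl opprB [RHS]addrC addrA subrK.
  by rewrite rpredB // scalar_part_split.
move=> H; have : (scalar_part a - c)%:A \in (1 :&: m)%VS.
  by rewrite memv_cap H andbT; apply: memvZ; apply: memv_line.
by rewrite weil_direct memv0 scaler_eq0 oner_eq0 orbF.
Qed.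

(* [scalar_part] is the algebra morphism with kernel [weil_ideal]. *)
Lemma scalar_part_is_linear : linear (scalar_part : A -> R^o).
Proof.
move=> c a b; apply: scalar_part_unique.
rewrite scalerDl -scalerA opprD addrACA -scalerBr.
by rewrite rpredD ?rpredZ // scalar_part_split.
Qed.

Lemma scalar_part1 : scalar_part 1 = 1.
Proof. by apply: scalar_part_unique; rewrite scale1r subrr mem0v. Qed.

Lemma scalar_partM a b : scalar_part (a * b) = scalar_part a * scalar_part b.
Proof.
have mulI c d : d \in m -> c * d \in m.
  move=> dI; have [idI _ _] := @weil_ideal_max R N A.
  by apply: (subvP idI); rewrite memv_mul ?memvf.
apply: scalar_part_unique.
have -> : a * b - (scalar_part a * scalar_part b)%:A
  = a * (b - (scalar_part b)%:A)
    + (scalar_part b)%:A * (a - (scalar_part a)%:A).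
  rewrite mulrBr mulrBr addrA [(scalar_part b)%:A * a]mulrC subrK.
  by rewrite -scalerAl mul1r scalerA [X in _ = _ - X *: _]mulrC.
by rewrite rpredD // mulI // scalar_part_split.
Qed.

Lemma scalar_part_eq0 a : (scalar_part a == 0) = (a \in m).
Proof.
apply/eqP/idP => [a0|aI].
  by have := scalar_part_split a; rewrite a0 scale0r subr0.
by apply: scalar_part_unique; rewrite scale0r subr0.
Qed.

End ScalarPart.

Section Calculus.
Context {R : realType} {p : nat} {W : normedModType R}.
Implicit Types (f : 'rV[R]_p -> W) (U : set 'rV[R]_p).

Definition partial (i : 'I_p) f : 'rV[R]_p -> W := 'D_(delta_mx 0 i) f.

Definition mpartial (alpha : multinom p) f : 'rV[R]_p -> W :=
  foldr (fun i g => iter (alpha i) (partial i) g) f (enum 'I_p).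

(* [f] is of class C^k on the open set [U]: all iterated partial derivatives of
   order at most [k] exist and are continuous on [U].  Only the values of [f]
   on [U] matter. *)
Fixpoint is_Ck (k : nat) U f : Prop :=
  (forall x, U x -> {for x, continuous f}) /\
  if k is k'.+1 then
    forall i : 'I_p,
      (forall x, U x -> derivable f x (delta_mx 0 i)) /\
      is_Ck k' U (partial i f)
  else True.

End Calculus.

Section Prolongation.
Context {R : realType} {N : nat} (A : weilAlgType R N) {p : nat}.
Implicit Types X H : 'rV[A]_p.

Definition scalar_parts X : 'rV[R]_p := map_mx scalar_part X.

Definition nil_parts X : 'rV[A]_p :=
  \row_i (X 0 i - (scalar_part (X 0 i))%:A).

Definition prolong_set (U : set 'rV[R]_p) : set 'rV[A]_p :=
  [set X | U (scalar_parts X)].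

Definition mfactorial (alpha : multinom p) : nat :=
  (\prod_(i < p) (alpha i)`!)%N.

(* [D alpha] stands for the [alpha]-th partial derivative at the base point;
   [bmultinom p N.+1] is the type of multi-indices of degree at most [N]. *)
Definition taylor_sum (D : multinom p -> R) H : A :=
  \sum_(alpha : bmultinom p N.+1)
    ((mfactorial alpha)%:R^-1 * D alpha) *: \prod_(i < p) H 0 i ^+ alpha i.

Definition prolong (f : 'rV[R]_p -> R) X : A :=
  taylor_sum (fun alpha => mpartial alpha f (scalar_parts X)) (nil_parts X).

Definition prolong_row {q : nat} (f : 'rV[R]_p -> 'rV[R]_q) X : 'rV[A]_q :=
  \row_j taylor_sum (fun alpha => mpartial alpha f (scalar_parts X) 0 j)
           (nil_parts X).

End Prolongation.

(* A polynomial map from [R^s] to [R^r], evaluated on [A^s] through the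
   structure morphism of the [R]-algebra [A]. *)
Definition polymap_eval {R : realType} {N : nat} (A : weilAlgType R N)
    {s r : nat} (P : 'I_r -> mpoly s R) (a : 'rV[A]_s) : 'rV[A]_r :=
  \row_k mmap (GRing.in_alg A) (fun i => a 0 i) (P k).

(* Main.v *)
Require Import Defs.
From HB Require Import structures.
From mathcomp Require Import all_boot all_order all_algebra falgebra.
From mathcomp Require Import all_classical all_reals all_analysis.
From mathcomp Require Import ring lra.
From mathcomp Require mpoly.
Import -(notations) mpoly.
Import Order.TTheory GRing.Theory Num.Theory.
Import numFieldNormedType.Exports.
Local Open Scope classical_set_scope.
Local Open Scope ring_scope.

(* If [G(F(x + t v)) = o(t^N)] along every line, where [G] is a polynomial and
   the [F_i] have Taylor polynomials [T_i] of degree [N] at [x], then the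
   polynomial [G(T)] is [o(t^N)] along every line as well, so it has no term of
   degree at most [N]; hence it vanishes at nilpotent arguments, because
   [m^(N+1) = 0].  The first statement is the case [G = P].  For the second one,
   [G] is the Taylor polynomial of a component of [h] at [f(x)], which agrees
   with [h] up to [o(t^N)] on the curves [t |-> f(x + t v)].
   The Taylor formula is obtained by expanding in one coordinate after the other,
   in the order in which [mpartial] differentiates, so that the symmetry of
   mixed partial derivatives is not needed. *)

(** * Polynomials vanishing along lines and nilpotent arguments *)

Lemma eq_mmap n (R S : nzRingType) (f g : R -> S) (h k : 'I_n -> S)
    (Q : mpoly n R) :
  f =1 g -> h =1 k -> mmap f h Q = mmap g k Q.
Proof.
move=> fg hk; apply: eq_bigr => m _; rewrite fg; congr (_ * _).
exact: mmap1_eq.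
Qed.

Lemma rmorph_mmap n (R S T : nzRingType) (g : {rmorphism S -> T}) (f : R -> S)
    (h : 'I_n -> S) (Q : mpoly n R) :
  g (mmap f h Q) = mmap (g \o f) (g \o h) Q.
Proof.
rewrite rmorph_sum; apply: eq_bigr => m _; rewrite rmorphM rmorph_prod.
by congr (_ * _); apply: eq_bigr => i _; rewrite rmorphXn.
Qed.

Lemma horner_mmap n (R : comNzRingType) (h : 'I_n -> {poly R})
    (Q : mpoly n R) (t : R) :
  (mmap polyC h Q).[t] = meval (fun j => (h j).[t]) Q.
Proof.
rewrite -[LHS]/(horner_eval t _) rmorph_mmap; apply: eq_mmap => //= c.
exact: hornerC.
Qed.

Section Vanishing.
Context {R : numFieldType} {n : nat}.
Implicit Types (Q : mpoly n R) (v : 'I_n -> R).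

(** Chain rule on the line through [v] in the direction of the [i]-th coordinate. The polynomials
    that satisfy it contain the constants and the variables and, by the Leibniz rule, are stable
    under sums and products. *)
Lemma deriv_mmap_line (i : 'I_n) v Q :
  let line j := (v j)%:P + (i == j)%:R%:P * 'X in
  (mmap polyC line Q)^`() = mmap polyC line (mderiv i Q).
Proof.
move=> line.
pose good P := (mmap polyC line P)^`() = mmap polyC line (mderiv i P).
have good0 : good 0 by rewrite /good mderiv0 mmap0 deriv0.
have goodD P1 P2 : good P1 -> good P2 -> good (P1 + P2).
  by rewrite /good mderivD !mmapD derivD => -> ->.
have goodM P1 P2 : good P1 -> good P2 -> good (P1 * P2).
  by rewrite /good mderivM mmapD !rmorphM /= derivM => -> ->.
have goodC c : good (mpolyC n c) by rewrite /good mderivC mmap0 mmapC derivC.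
have goodX j : good (mpolyX R (mnm1 j)).
  rewrite /good mderivX mnm1E mmapZ !mmapX mmap1U derivD derivC add0r.
  rewrite derivM derivC mul0r add0r derivX mulr1 eq_sym.
  have [->|] := eqVneq j i; last by rewrite polyC0 mul0r.
  have -> : mnm_sub (mnm1 i) (mnm1 i) = mnm0.
    by apply/mnmP => k; rewrite mnmBE mnm0E subnn.
  by rewrite mul1r mmap11.
suff : good Q by [].
rewrite [Q]mpolyE; apply: (big_ind good good0 goodD) => m _.
rewrite -mul_mpolyC; apply: (goodM) => //; rewrite mpolyXE_id.
apply: (big_ind good (goodC 1) goodM).
move=> j _; elim: (m j) => [|k IHk]; first exact: (goodC 1).
by rewrite exprS; apply: goodM.
Qed.

(** On a line parallel to the [i]-th axis, [Q] is a univariate polynomial with infinitely many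
    roots; it is therefore zero as a polynomial, and so is its derivative. *)
Lemma meval_mderiv_eq0 Q i :
  (forall v, meval v Q = 0) -> forall v, meval v (mderiv i Q) = 0.
Proof.
move=> Q0 v.
pose line j := (v j)%:P + (i == j)%:R%:P * 'X.
have q0 : mmap polyC line Q = 0.
  apply/eqP; apply/negPn/negP => qn0.
  (* As many natural numbers as the size of the polynomial: one root more than its degree allows.
     They are distinct in characteristic zero. *)
  pose s := [seq k%:R : R | k <- iota 0 (size (mmap polyC line Q))].
  have := max_poly_roots (rs := s) qn0; rewrite size_map size_iota ltnn.
  move=> H; suff : false by []; apply: H.
    by apply/allP => x _; rewrite rootE horner_mmap Q0.
  by rewrite map_inj_uniq ?iota_uniq // => a b /eqP; rewrite eqr_nat => /eqP.
have := horner_mmap _ _ line (mderiv i Q) 0.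
rewrite -deriv_mmap_line q0 deriv0 horner0 => ->; apply: meval_eq => j.
by rewrite hornerD hornerC hornerM hornerX mulr0 addr0.
Qed.

Lemma meval_at0 Q : meval (fun=> 0) Q = mcoeff mnm0 Q.
Proof.
rewrite mevalE [in RHS](mpolyE Q) raddf_sum; apply: eq_bigr => m _ /=.
rewrite mcoeffZ mcoeffX; congr (_ * _).
have [->|] := eqVneq m mnm0; first by rewrite big1 // => i _; rewrite mnm0E.
rewrite -mdeg_eq0 mdegE sum_nat_eq0 => /forallPn /= [i mi].
by rewrite (bigD1 i) //= expr0n (negPf mi) mul0r.
Qed.

(** Every iterated formal derivative of [Q] also vanishes as a function; its value at 0 is a
    coefficient of [Q] times a product of factorials, which is nonzero in [R]. *)
Lemma meval_eq0 Q : (forall v, meval v Q = 0) -> Q = 0.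
Proof.
move=> Q0; apply/mpolyP => m; rewrite mcoeff0.
have Qm : forall v, meval v (mderivm m Q) = 0.
  rewrite mderivm_foldr; elim: (flatten _) => //= i l IHl.
  exact: meval_mderiv_eq0.
have := meval_at0 (mderivm m Q); rewrite Qm mcoeff_mderivm addm0 => /esym/eqP.
rewrite mulrn_eq0 => /orP[|/eqP //]; rewrite -leqn0 leqNgt.
by rewrite prodn_gt0 // => i; rewrite ffact_gt0.
Qed.

(** The coefficient of [t^k] in [Q(t v)] is the value at [v] of the homogeneous component of degree
    [k], called [q] below, to which [meval_eq0] applies. *)
Lemma mcoeff_eq0_line (k : nat) Q :
  (forall v, (mmap polyC (fun j => (v j)%:P * 'X) Q)`_k = 0) ->
  forall m, mdeg m = k -> mcoeff m Q = 0.
Proof.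
move=> Qk m mk.
pose q := \sum_(m <- msupp Q | mdeg m == k) mcoeff m Q *: mpolyX R m.
have q0 : q = 0.
  apply: meval_eq0 => v; rewrite -[RHS](Qk v) raddf_sum coef_sum /=.
  rewrite big_mkcond /=; apply: eq_bigr => a _.
  have -> : mmap1 (fun j => (v j)%:P * 'X) a = (mmap1 v a)%:P * 'X^(mdeg a).
    rewrite mdegE -prodrXr rmorph_prod -big_split /=.
    by apply: eq_bigr => j _; rewrite exprMn rmorphXn.
  rewrite mulrA -polyCM coefCM coefXn eq_sym; case: eqP; rewrite ?mulr0 //.
  by rewrite mulr1 mevalZ mevalX.
rewrite [Q]mpolyE (bigID (fun a => mdeg a == k)) /= -/q q0 add0r raddf_sum /=.
rewrite big1 // => a ak; rewrite mcoeffZ mcoeffX.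
have [am|] := eqVneq a m; last by rewrite mulr0.
by rewrite am mk eqxx in ak.
Qed.

End Vanishing.

Section Nilpotent.
Context {R : realType} {N : nat} {A : weilAlgType R N}.
Local Notation m := (weil_ideal : {vspace A}).

Lemma weil_idealM (a b : A) : b \in m -> a * b \in m.
Proof.
move=> bm; have [idm _ _] := @weil_ideal_max R N A.
by apply: (subvP idm); rewrite memv_mul ?memvf.
Qed.

(** A monomial of degree [d] in elements of [m] lies in [m^d], and [m^d] is contained in
    [m^(N+1) = 0] once [d > N]. *)
Lemma monomial_nilpotent {p} (H : 'I_p -> A) (alpha : multinom p) :
  (forall i, H i \in m) -> (N < mdeg alpha)%N -> mmap1 H alpha = 0.
Proof.
move=> Hm.
have step (u w : A) a b : u \in (m ^+ a)%VS -> w \in (m ^+ b)%VS ->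
    u * w \in (m ^+ (a + b))%VS.
  by move=> ua wb; rewrite expvD memv_mul.
have : mmap1 H alpha \in (m ^+ mdeg alpha)%VS.
  rewrite mdegE /mmap1; elim/big_ind2: _ => [||i _].
  - by rewrite expv0 memv_line.
  - by move=> u a w b; apply: step.
  elim: (alpha i) => [|k IHk]; first by rewrite expr0 expv0 memv_line.
  by rewrite exprS expvSl memv_mul.
move=> + ltN; rewrite -(subnK ltN) addnC expvD weil_nil prod0v memv0.
by move/eqP.
Qed.

Lemma mmap_nilpotent_eq0 {p} (H : 'I_p -> A) (Q : mpoly p R) :
  (forall i, H i \in m) ->
  (forall alpha, (mdeg alpha <= N)%N -> mcoeff alpha Q = 0) ->
  mmap (GRing.in_alg A) H Q = 0.
Proof.
move=> Hm Q0; apply: big1 => alpha _.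
have [/Q0 ->|/(monomial_nilpotent H) ->//] := leqP (mdeg alpha) N.
  by rewrite rmorph0 mul0r.
by rewrite mulr0.
Qed.

End Nilpotent.

(** * Taylor expansion in one coordinate *)

(** The symmetric range [|b| <= |a|] covers both signs of the increment [a] at once, as
    [taylor_step] requires. *)
Lemma MVT0 (R : realType) (phi dphi : R -> R) (a : R) :
  (forall b, `|b| <= `|a| -> is_derive b (1 : R) phi (dphi b)) ->
  exists2 c, `|c| <= `|a| & phi a - phi 0 = dphi c * a.
Proof.
move=> dphiP; have [a0|a0] := leP 0 a.
  have Pin b : b \in `[0, a] -> `|b| <= `|a|.
    by rewrite in_itv /= => /andP[b0 ba]; rewrite !ger0_norm.
  have [c /Pin ca ->] : exists2 c, c \in `[0, a]%R &
      phi a - phi 0 = dphi c * (a - 0).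
    apply: MVT_segment => // [b /subset_itv_oo_cc /Pin /dphiP //|].
    by apply: derivable_within_continuous => b /Pin /dphiP [].
  by exists c; rewrite ?subr0.
have Pin b : b \in `[a, 0] -> `|b| <= `|a|.
  by rewrite in_itv /= => /andP[b0 ba]; rewrite !ler0_norm ?lerN2 // ltW.
have [c /Pin ca H] : exists2 c, c \in `[a, 0]%R &
    phi 0 - phi a = dphi c * (0 - a).
  apply: MVT_segment => [|b /subset_itv_oo_cc /Pin /dphiP //|]; first exact: ltW.
  by apply: derivable_within_continuous => b /Pin /dphiP [].
by exists c => //; rewrite -opprB H sub0r mulrN opprK.
Qed.

Section TaylorStep.
Context {R : realType} {W : normedModType R} (L : W -> R).
Hypothesis linL : forall a u v, L (a *: u + v) = a * L u + L v.
Hypothesis contL : continuous L.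

(** The functional [L] reduces vector-valued maps to real ones: it commutes with difference
    quotients and, being continuous, with their limits. It is later the identity of [R] or a
    coordinate of a row vector. *)
Lemma is_derive_line {V : normedModType R} (g : V -> W) (z e : V) (a : R) :
  derivable g (z + a *: e) e ->
  is_derive a (1 : R) (fun b => L (g (z + b *: e))) (L ('D_e g (z + a *: e))).
Proof.
move=> dg; have LB u v : L (u - v) = L u - L v.
  by rewrite addrC -scaleN1r linL mulN1r addrC.
have LZ c u : L (c *: u) = c * L u.
  by rewrite -[c *: u]addr0 linL -(subrr u) LB subrr addr0.
have H : h^-1 *: (((fun b => L (g (z + b *: e))) \o shift a) (h *: (1 : R))
      - L (g (z + a *: e))) @[h --> 0^'] --> L ('D_e g (z + a *: e)).
  refine (cvg_trans _ (continuous_cvg _ (contL _) dg)).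
  apply: near_eq_cvg; near=> h.
  rewrite /= LZ LB; congr (_ * (L (g _) - _)).
  by rewrite scalerDl addrCA /shift /= -[_%:A]/(h * 1) mulr1.
apply: DeriveDef; first by apply/cvg_ex; exists (L ('D_e g (z + a *: e))).
exact: cvg_lim H.
Unshelve. all: by end_near. Qed.

Lemma near_line {V : normedModType R} (x e : V) (P : V -> Prop) :
  (\forall y \near x, P y) ->
  exists2 delta, 0 < delta & forall z (a : R),
    `|x - z| < delta -> `|a| < delta -> P (z + a *: e).
Proof.
move=> /nbhs_normP [eta /= eta0 etaP]; have e1 : 0 < 1 + `|e| by rewrite ltr_pwDl.
(* The distance from [x] to [z + a e] is at most [|x - z| + |a| |e| < delta (1 + |e|) = eta]. *)
exists (eta / (1 + `|e|)) => [|z a]; first by rewrite divr_gt0.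
rewrite !ltr_pdivlMr // => zx ax; apply: etaP => /=.
rewrite opprD addrA (le_lt_trans (ler_normB _ _)) // normrZ.
have := normr_ge0 (x - z); have := normr_ge0 a; have := normr_ge0 e.
move: zx ax; nra.
Qed.

Context {p : nat}.
Implicit Types (U : set 'rV[R]_p) (g : 'rV[R]_p -> W).

Lemma is_Ck_continuous k U g x : is_Ck k U g -> U x -> {for x, continuous g}.
Proof. by case: k => [|k] [cg _]; exact: cg. Qed.

(* The expansion is uniform in the base point [z] near [x]. *)
Lemma taylor_step k U g x (i : 'I_p) : open U -> is_Ck k U g -> U x ->
  forall eps, 0 < eps -> exists2 delta, 0 < delta & forall z a,
    `|x - z| < delta -> `|a| < delta ->
    `|L (g (z + a *: delta_mx 0 i))
      - (\poly_(n < k.+1) (L (iter n (partial i) g z) / n`!%:R)).[a]|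
    <= eps * `|a| ^+ k.
Proof.
move=> oU; elim: k g => [|k IHk] g gk Ux eps eps0; set e := delta_mx 0 i.
  have /cvgr_dist_le H : L (g y) @[y --> x] --> L (g x).
    exact: (continuous_cvg _ (contL _) (is_Ck_continuous _ _ _ _ gk Ux)).
  have /H /(near_line _ e) [delta delta0 deltaP] : 0 < eps / 2 by rewrite divr_gt0.
  exists delta => // z a zx ax.
  rewrite horner_poly big_ord1 fact0 divr1 expr0 !mulr1 /=.
  (* At order 0, continuity at [x] is used at both [z + a e] and [z], the latter as the case
     [a = 0]; each contributes [eps / 2]. *)
  have -> : L (g (z + a *: e)) - L (g z)
      = (L (g x) - L (g z)) - (L (g x) - L (g (z + a *: e))).
    by ring.
  rewrite [eps]splitr (le_trans (ler_normB _ _)) // lerD ?deltaP //.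
  by have := deltaP z 0 zx; rewrite normr0 scale0r addr0; exact.
have [_ /(_ i)[dg gk']] := gk.
have [delta1 delta10 delta1P] := IHk _ gk' Ux eps eps0.
have [delta2 delta20 delta2P] := near_line x e _ (open_nbhs_nbhs (conj oU Ux)).
exists (Num.min delta1 delta2); first by rewrite lt_min delta10.
move=> z a; rewrite !lt_min => /andP[zx1 zx2] /andP[ax1 ax2].
set P := \poly_(n < _) _; pose P' := P^`().
(* Differentiating the Taylor polynomial of [g] in the increment gives that of [partial i g], one
   degree lower. The mean value theorem thus bounds the remainder [phi] by [|a|] times the remainder
   of [partial i g], which the induction hypothesis controls. *)
have P'E : P' = \poly_(n < k.+1) (L (iter n (partial i) (partial i g) z) / n`!%:R).
  apply/polyP => n; rewrite coef_deriv !coef_poly ltnS; case: ltnP => nk;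
    last by rewrite mul0rn.
  rewrite iterSr factS natrM -mulr_natr; field.
  by rewrite nat1r !pnatr_eq0 -lt0n fact_gt0.
pose phi b := L (g (z + b *: e)) - P.[b].
pose dphi b := L (partial i g (z + b *: e)) - P'.[b].
have [b ba|c ca] := @MVT0 _ phi dphi a.
  apply: is_deriveB; apply: is_derive_line; apply: dg; apply: delta2P => //.
  exact: le_lt_trans ba _.
have phi0 : phi 0 = 0.
  by rewrite /phi scale0r addr0 horner_coef0 coef_poly /= fact0 divr1 subrr.
rewrite phi0 subr0 => phia; rewrite -[_ - _]/(phi a) phia.
rewrite normrM exprSr mulrA ler_wpM2r // /dphi P'E.
apply: le_trans (delta1P _ _ zx1 (le_lt_trans ca ax1)) _.
by rewrite ler_wpM2l ?lerXn2r ?nnegrE // ltW.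
Qed.

End TaylorStep.

(** * Orders of magnitude at 0 *)

Section Small.
Context {R : realType}.
Implicit Types (f g : R -> R).

(** Landau's [O(t^k)] at 0; [small] below is [o(t^k)]. The neighbourhoods are punctured, so that
    [small_poly] can divide by [t]. *)
Definition dominated (k : nat) f :=
  exists C, \forall t \near 0^', `|f t| <= C * `|t| ^+ k.

Definition small (k : nat) f :=
  forall eps, 0 < eps -> \forall t \near 0^', `|f t| <= eps * `|t| ^+ k.

Lemma eq_small k f g : f =1 g -> small k f -> small k g.
Proof. by move=> /funext ->. Qed.

Lemma eq_dominated k f g : f =1 g -> dominated k f -> dominated k g.
Proof. by move=> /funext ->. Qed.

Lemma small0 k : small k (fun=> 0).
Proof.
by move=> e e0; near=> t; rewrite normr0 mulr_ge0 ?exprn_ge0 // ltW.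
Unshelve. all: by end_near. Qed.

Lemma smallD k f g : small k f -> small k g -> small k (fun t => f t + g t).
Proof.
move=> fk gk e e0; have e20 : 0 < e / 2 by rewrite divr_gt0.
near=> t; rewrite (le_trans (ler_normD _ _)) // [e]splitr mulrDl.
rewrite lerD //; near: t; [exact: fk|exact: gk].
Unshelve. all: by end_near. Qed.

Lemma smallN k f : small k f -> small k (fun t => - f t).
Proof. by move=> fk e e0; near=> t; rewrite normrN; near: t; exact: fk.
Unshelve. all: by end_near. Qed.

Lemma small_sum k (I : Type) (r : seq I) (P : pred I) (F : I -> R -> R) :
  (forall i, P i -> small k (F i)) ->
  small k (fun t => \sum_(i <- r | P i) F i t).
Proof.
move=> Fk; elim: r => [|i r IHr].
  by apply: eq_small (small0 k) => t; rewrite big_nil.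
have [Pi|Pi] := boolP (P i).
  by apply: eq_small (smallD _ _ _ (Fk i Pi) IHr) => t; rewrite big_cons Pi.
by apply: eq_small IHr => t; rewrite big_cons (negPf Pi).
Qed.

Lemma small_le k f g : small k g -> (\forall t \near 0^', `|f t| <= `|g t|) ->
  small k f.
Proof.
move=> gk fg e e0; near=> t; apply: (@le_trans _ _ `|g t|); near: t => //.
exact: gk.
Unshelve. all: by end_near. Qed.

Lemma dominated_gt0 k f : dominated k f ->
  exists2 C, 0 < C & \forall t \near 0^', `|f t| <= C * `|t| ^+ k.
Proof.
move=> [C fC]; exists (`|C| + 1); first by rewrite ltr_pwDr.
near=> t; apply: (@le_trans _ _ (C * `|t| ^+ k)); first by near: t.
rewrite ler_wpM2r ?exprn_ge0 // (le_trans (ler_norm _)) // lerDl //.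
Unshelve. all: by end_near. Qed.

Lemma dominatedM j k f g : dominated j f -> dominated k g ->
  dominated (j + k) (fun t => f t * g t).
Proof.
move=> /dominated_gt0[C C0 fC] /dominated_gt0[D D0 gD]; exists (C * D).
near=> t; rewrite normrM exprD mulrACA ler_pM //; by near: t.
Unshelve. all: by end_near. Qed.

Lemma small_domM j k f g : dominated j f -> small k g ->
  small (j + k) (fun t => f t * g t).
Proof.
move=> /dominated_gt0[C C0 fC] gk e e0.
have eC : 0 < e / C by rewrite divr_gt0.
near=> t; rewrite normrM exprD.
have -> : e * (`|t| ^+ j * `|t| ^+ k) = C * `|t| ^+ j * (e / C * `|t| ^+ k).
  by field; rewrite gt_eqF.
rewrite ler_pM //; near: t; [exact: fC|exact: gk].
Unshelve. all: by end_near. Qed.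

Lemma dominated_cst c : dominated 0 (fun=> c).
Proof. by exists `|c|; near=> t; rewrite expr0 mulr1.
Unshelve. all: by end_near. Qed.

Lemma dominatedD k f g : dominated k f -> dominated k g ->
  dominated k (fun t => f t + g t).
Proof.
move=> [C fC] [D gD]; exists (C + D); near=> t.
rewrite (le_trans (ler_normD _ _)) // mulrDl lerD //; by near: t.
Unshelve. all: by end_near. Qed.

Lemma dominated_sum k (I : Type) (r : seq I) (P : pred I) (F : I -> R -> R) :
  (forall i, P i -> dominated k (F i)) ->
  dominated k (fun t => \sum_(i <- r | P i) F i t).
Proof.
move=> Fk; elim: r => [|i r IHr].
  by exists 0; near=> t; rewrite big_nil normr0 mul0r.
have [Pi|Pi] := boolP (P i).
  by apply: eq_dominated (dominatedD _ _ _ (Fk i Pi) IHr) => t; rewrite big_cons Pi.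
by apply: eq_dominated IHr => t; rewrite big_cons (negPf Pi).
Unshelve. all: by end_near. Qed.

Lemma small_dominated k f : small k f -> dominated k f.
Proof. by move=> /(_ 1 ltr01) H; exists 1. Qed.

Lemma dominated_leq j k f : (j <= k)%N -> dominated k f -> dominated j f.
Proof.
move=> jk /dominated_gt0[C C0 fC]; exists C; near=> t.
have t1 : `|t| <= 1 by near: t; exact: dnbhs0_le.
apply: (@le_trans _ _ (C * `|t| ^+ k)); first by near: t.
rewrite ler_pM2l //; exact: ler_wiXn2l.
Unshelve. all: by end_near. Qed.

Lemma dominatedX j n f : dominated j f -> dominated (j * n) (fun t => f t ^+ n).
Proof.
move=> fj; elim: n => [|n IHn]; first by rewrite muln0; exact: dominated_cst.
by rewrite mulnS; apply: eq_dominated (dominatedM _ _ _ _ fj IHn) => t; rewrite exprS.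
Qed.

Lemma cvg_dominated f (l : R) : f t @[t --> (0 : R)^'] --> l -> dominated 0 f.
Proof.
move=> /cvgr_dist_le /(_ 1 ltr01) fl; exists (1 + `|l|); near=> t.
rewrite expr0 mulr1 -lerBlDr; apply: (@le_trans _ _ `|l - f t|); last by near: t.
by rewrite distrC; exact: lerB_dist.
Unshelve. all: by end_near. Qed.

(** Products of bounded functions preserve closeness, since
    [f g - f' g' = f (g - g') + g' (f - f')]; sums do so too. The claim follows by building [P] from
    constants and variables. *)
Lemma small_meval k n (P : mpoly n R) (F G : 'I_n -> R -> R) :
  (forall i, dominated 0 (F i)) -> (forall i, dominated 0 (G i)) ->
  (forall i, small k (fun t => F i t - G i t)) ->
  small k (fun t => meval (F^~ t) P - meval (G^~ t) P).
Proof.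
move=> F0 G0 FG.
pose sim f g := [/\ dominated 0 f, dominated 0 g & small k (fun t => f t - g t)].
have simC c : sim (fun=> c) (fun=> c).
  split; [exact: dominated_cst|exact: dominated_cst|].
  by apply: eq_small (small0 k) => t; rewrite subrr.
have simM f f' g g' : sim f f' -> sim g g' ->
    sim (fun t => f t * g t) (fun t => f' t * g' t).
  move=> [f0 f'0 ff'] [g0 g'0 gg']; split;
    [exact: dominatedM f0 g0|exact: dominatedM f'0 g'0|].
  apply: eq_small (smallD _ _ _ (small_domM _ _ _ _ f0 gg')
    (small_domM _ _ _ _ g'0 ff')) => t.
  by ring.
have simD f f' g g' : sim f f' -> sim g g' ->
    sim (fun t => f t + g t) (fun t => f' t + g' t).
  move=> [f0 f'0 ff'] [g0 g'0 gg']; split;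
    [exact: dominatedD|exact: dominatedD|].
  by apply: eq_small (smallD _ _ _ ff' gg') => t; ring.
pose good P := sim (fun t => meval (F^~ t) P) (fun t => meval (G^~ t) P).
have goodE Q (f g : R -> R) : sim f g -> (forall t, meval (F^~ t) Q = f t) ->
    (forall t, meval (G^~ t) Q = g t) -> good Q.
  by move=> fg /funext Qf /funext Qg; rewrite /good Qf Qg.
have goodC c : good (mpolyC n c).
  by apply: goodE (simC c) _ _ => t; rewrite mevalC.
have goodD P1 P2 : good P1 -> good P2 -> good (P1 + P2).
  by move=> P1g P2g; apply: goodE (simD _ _ _ _ P1g P2g) _ _ => t; rewrite mevalD.
have goodM P1 P2 : good P1 -> good P2 -> good (P1 * P2).
  by move=> P1g P2g; apply: goodE (simM _ _ _ _ P1g P2g) _ _ => t; rewrite mevalM.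
have goodX j : good (mpolyX R (mnm1 j)).
  by apply: goodE (And3 (F0 j) (G0 j) (FG j)) _ _ => t; rewrite mevalXU.
suff [] : good P by [].
rewrite [P]mpolyE; apply: (big_ind good (goodC 0) goodD) => m _.
rewrite -mul_mpolyC; apply: (goodM) => //; rewrite mpolyXE_id.
apply: (big_ind good (goodC 1) goodM) => j _.
elim: (m j) => [|a IHa]; first exact: (goodC 1).
by rewrite exprS; apply: (goodM).
Qed.

End Small.

(** * Taylor expansion along a curve *)

Section MultiIndices.
Context {p K : nat}.
Implicit Types (alpha : multinom p) (l : seq 'I_p).

Definition supported l alpha := [forall j, (j \notin l) ==> (alpha j == 0%N)].

Lemma supportedP l alpha :
  reflect (forall j, j \notin l -> alpha j = 0%N) (supported l alpha).
Proof.
apply: (iffP forallP) => H j; first by move=> jl; apply/eqP/(implyP (H j)).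
by apply/implyP => /H ->.
Qed.

Definition mnm_cons (i : 'I_p) (n : nat) alpha :=
  mnm_add alpha (mnm_muln (mnm1 i) n).

Lemma mnm_consE i n alpha j : mnm_cons i n alpha j = (alpha j + (i == j) * n)%N.
Proof. by rewrite mnmDE mulmnE mnm1E. Qed.

Lemma mdeg_cons i n alpha : mdeg (mnm_cons i n alpha) = (mdeg alpha + n)%N.
Proof. by rewrite mdegD mdegMn mdeg1 mul1n. Qed.

Lemma supported_nil alpha : supported [::] alpha = (alpha == mnm0).
Proof.
apply/supportedP/eqP => [H|-> j _]; last exact: mnm0E.
by apply/mnmP => j; rewrite H // mnm0E.
Qed.

(** Each index on the left is uniquely [beta + n e_i], where [n] is its exponent at [i] and [beta]
    is supported in [l]. The bound [k <= K] keeps all these indices in [bmultinom p K.+1]. *)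
Lemma sum_supported_rcons (V : nmodType) l (i : 'I_p) (k : nat)
    (F : multinom p -> V) : i \notin l -> (k <= K)%N ->
  \sum_(alpha : bmultinom p K.+1 |
         (mdeg alpha <= k)%N && supported (rcons l i) alpha)
     F alpha
  = \sum_(n < k.+1)
      \sum_(alpha : bmultinom p K.+1 |
           (mdeg alpha <= k - n)%N && supported l alpha)
        F (mnm_cons i n alpha).
Proof.
move=> il kK; pose b0 : bmultinom p K.+1 := BMultinom (bm0_proof p K).
rewrite (partition_big
  (fun alpha : bmultinom p K.+1 => inord (alpha i) : 'I_k.+1) xpredT) //=.
apply: eq_bigr => n _.
(* [h] adds [n e_i] and [h'] removes it. When the degree would exceed [K], [insubd] returns the zero
   index [b0]; [hE] excludes this on the range of summation. *)
pose h (alpha : bmultinom p K.+1) := insubd b0 (mnm_cons i n alpha).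
pose h' (alpha : bmultinom p K.+1) :=
  insubd b0 (mnm_sub alpha (mnm_muln (mnm1 i) n)).
have dk a : (a <= k - n)%N = (a + n <= k)%N by rewrite addnC leq_subRL // -ltnS.
have hE (alpha : bmultinom p K.+1) :
    (mdeg alpha <= k - n)%N -> val (h alpha) = mnm_cons i n alpha.
  move=> ak; rewrite insubdK // unfold_in mdeg_cons ltnS (leq_trans _ kK) //.
  by rewrite -dk.
have h'E (alpha : bmultinom p K.+1) :
    val (h' alpha) = mnm_sub alpha (mnm_muln (mnm1 i) n).
  by rewrite insubdK // unfold_in (leq_ltn_trans (mdegB _ _)) // bmdeg.
have le_mdeg (alpha : multinom p) : (alpha i <= mdeg alpha)%N.
  by rewrite mdegE (bigD1 i) //= leq_addr.
rewrite (reindex_onto h h') /=; last first.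
  move=> alpha /andP[/andP[ak _] /eqP/(congr1 val)]; rewrite /= inordK; last first.
    by rewrite ltnS (leq_trans _ ak).
  move=> an; apply: val_inj.
  have sub : mnm_add (val (h' alpha)) (mnm_muln (mnm1 i) n) = alpha.
    by rewrite h'E submK //; apply/mnm_lepP => j; rewrite mulmnE mnm1E -an;
       case: eqP => [->|]; rewrite ?mul1n.
  rewrite hE //.
  have := congr1 mdeg sub; rewrite mdegD mdegMn mdeg1 mul1n => def_a.
  by rewrite dk def_a.
have pE (alpha : bmultinom p K.+1) :
    [&& (mdeg (h alpha) <= k)%N && supported (rcons l i) (h alpha),
        (inord (h alpha i) : 'I_k.+1) == n & h' (h alpha) == alpha]
    = (mdeg alpha <= k - n)%N && supported l alpha; last first.
  apply: eq_big => alpha; first by rewrite -pE !andbA.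
  by rewrite -andbA pE => /andP[/hE <-].
apply/idP/idP => [/and3P[/andP[hk /supportedP hs] /eqP hn _]|
                   /andP[ak /supportedP al]].
  have ik : (h alpha i < k.+1)%N by rewrite ltnS (leq_trans (le_mdeg _)).
  have hcons : val (h alpha) = mnm_cons i n alpha.
    (* If [h alpha] were the default [b0], its exponent at [i] would be 0, so [n = 0]; but then
       [mnm_cons i n alpha] has the degree of [alpha] and stays within the bound. *)
    rewrite val_insubd mdeg_cons; case: ifPn => // nK; exfalso.
    have := congr1 val hn; rewrite /= inordK //.
    rewrite [bmnm _]val_insubd mdeg_cons (negPf nK) mnm0E => n0.
    by rewrite -n0 addn0 bmdeg in nK.
  have := congr1 val hn; rewrite /= inordK //.
  rewrite -[bmnm _]/(val (h alpha)) hcons mnm_consE eqxx mul1n => /eqP.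
  rewrite -{2}(add0n (n : nat)) eqn_add2r => /eqP ai.
  rewrite -[bmnm _]/(val (h alpha)) hcons mdeg_cons in hk.
  rewrite dk hk /=; apply/supportedP => j jl.
  have [<-//|ij] := eqVneq i j.
  have := hs j; rewrite -[bmnm _]/(val (h alpha)) hcons mnm_consE (negPf ij).
  by rewrite addn0; apply; rewrite mem_rcons inE negb_or eq_sym ij.
have hcons := hE _ ak.
have hk : (mdeg alpha + n <= k)%N by rewrite -dk.
rewrite -!andbA; apply/and4P; split.
- by rewrite -[bmnm _]/(val (h alpha)) hcons mdeg_cons.
- apply/supportedP => j; rewrite mem_rcons inE negb_or => /andP[ji jl].
  by rewrite -[bmnm _]/(val (h alpha)) hcons mnm_consE eq_sym (negPf ji) al.
- by rewrite -[bmnm _]/(val (h alpha)) hcons mnm_consE eqxx mul1n al //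
     add0n inord_val.
apply/eqP/val_inj; rewrite h'E -[bmnm (h alpha)]/(val (h alpha)) hcons.
apply/mnmP => j; rewrite mnmBE mnm_consE mulmnE mnm1E; exact: addnK.
Qed.

End MultiIndices.

Section TaylorCurve.
Context {R : realType} {W : normedModType R} (L : W -> R).
Hypothesis linL : forall a u v, L (a *: u + v) = a * L u + L v.
Hypothesis contL : continuous L.
Context {p : nat} (U : set 'rV[R]_p) (Uopen : open U).
Implicit Types (g : 'rV[R]_p -> W).

(* [mpartial] is the case [l = enum 'I_p]. *)
Definition mpartial_seq (l : seq 'I_p) (alpha : multinom p) g :=
  foldr (fun i => iter (alpha i) (partial i)) g l.

Lemma is_Ck_iter i n k g : is_Ck (n + k) U g -> is_Ck k U (iter n (partial i) g).
Proof.
elim: n g => // n IHn g [_ /(_ i)[_ gnk]].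
by rewrite iterSr; exact: IHn.
Qed.

Definition monomial (h : 'I_p -> R) (alpha : multinom p) :=
  (mfactorial alpha)%:R^-1 * mmap1 h alpha.

Lemma monomial0 h : monomial h mnm0 = 1.
Proof.
by rewrite /monomial mmap11 /mfactorial big1 ?invr1 ?mulr1 // => i _; rewrite mnm0E.
Qed.

Lemma monomial_cons h i n (alpha : multinom p) : alpha i = 0%N ->
  monomial h (mnm_cons i n alpha) = n`!%:R^-1 * h i ^+ n * monomial h alpha.
Proof.
move=> ai; have consj (j : 'I_p) : j != i -> mnm_cons i n alpha j = alpha j.
  by rewrite mnm_consE eq_sym => /negPf ->; rewrite addn0.
have consi : mnm_cons i n alpha i = n by rewrite mnm_consE ai eqxx mul1n.
have fE : mfactorial (mnm_cons i n alpha) = (n`! * mfactorial alpha)%N.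
  rewrite /mfactorial (bigD1 i) //= [in RHS](bigD1 i) //= consi ai mul1n.
  by congr (_ * _)%N; apply: eq_bigr => j /consj ->.
have hE : mmap1 h (mnm_cons i n alpha) = h i ^+ n * mmap1 h alpha.
  rewrite /mmap1 (bigD1 i) //= [in RHS](bigD1 i) //= consi ai mul1r.
  by congr (_ * _); apply: eq_bigr => j /consj ->.
by rewrite /monomial fE hE natrM invfM mulrACA.
Qed.

Context (K : nat) (x : 'rV[R]_p) (Ux : U x) (w : R -> 'rV[R]_p).
Hypothesis w0 : forall j, w t 0 j @[t --> (0 : R)^'] --> (0 : R).
(** Powers are restricted to [n <= K] so that [K = 0] admits merely continuous curves: the increment
    of a [C^0] map need not be [O(t)]. *)
Hypothesis wK : forall j n, (n <= K)%N -> dominated n (fun t => w t 0 j ^+ n).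

Let taylor_part l k g t :=
  \sum_(alpha : bmultinom p K.+1 | (mdeg alpha <= k)%N && supported l alpha)
     L (mpartial_seq l alpha g x) * monomial (w t 0) alpha.

(** In [mpartial_seq (rcons l i)] the derivatives in [i] are the innermost ones, so the derivatives
    along [l] act on [iter n (partial i) g]. *)
Lemma taylor_part_rcons l i k g t : i \notin l -> (k <= K)%N ->
  taylor_part (rcons l i) k g t =
  \sum_(n < k.+1) n`!%:R^-1 * w t 0 i ^+ n
    * taylor_part l (k - n) (iter n (partial i) g) t.
Proof.
move=> il kK; rewrite /taylor_part.
rewrite (sum_supported_rcons _ _ _ _
  (fun alpha => L (mpartial_seq (rcons l i) alpha g x) * monomial (w t 0) alpha)) //.
apply: eq_bigr => n _; rewrite mulr_sumr; apply: eq_bigr => alpha.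
move=> /andP[_ /supportedP al]; rewrite monomial_cons ?al // mulrCA.
congr (_ * (L (_ x) * _)); rewrite /mpartial_seq foldr_rcons mnm_consE.
rewrite al // eqxx mul1n.
elim: l il {al} => //= j l IHl; rewrite inE negb_or => /andP[ij il].
by rewrite IHl // mnm_consE (negPf ij) addn0.
Qed.

(** Induction from the right end of [l]: expand in the last coordinate [i] at the moving point
    [z t], then expand the coefficients, as functions of [z t], in the coordinates of [l] by the
    induction hypothesis. *)
Lemma taylor_curve_seq l k g : uniq l -> (k <= K)%N -> is_Ck k U g ->
  small k (fun t => L (g (x + \sum_(j <- l) w t 0 j *: delta_mx 0 j))
                    - taylor_part l k g t).
Proof.
elim/last_ind: l k g => [|l i IHl] k g.
  move=> _ kK gk; apply: eq_small (small0 k) => t.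
  rewrite big_nil addr0 /taylor_part.
  rewrite (big_pred1 (BMultinom (bm0_proof p K) : bmultinom p K.+1)) /=.
    by rewrite monomial0 mulr1 subrr.
  move=> alpha; rewrite supported_nil -[RHS]/(bmnm alpha == mnm0).
  by case: eqP => [->|]; rewrite ?andbF // mdeg0 andbT.
rewrite rcons_uniq => /andP[il lu] kK gk.
pose z t := x + \sum_(j <- l) w t 0 j *: delta_mx 0 j.
have sum0 : \sum_(j <- l) w t 0 j *: delta_mx 0 j @[t --> (0 : R)^']
    --> (0 : 'rV[R]_p).
  elim: l {IHl il lu z} => [|j l IHl].
    by under eq_fun do rewrite big_nil; exact: cvg_cst.
  under eq_fun do rewrite big_cons.
  suff : w t 0 j *: delta_mx 0 j + \sum_(j0 <- l) w t 0 j0 *: delta_mx 0 j0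
    @[t --> (0 : R)^'] --> 0 *: delta_mx 0 j + (0 : 'rV[R]_p).
    by rewrite scale0r addr0.
  by apply: cvgD => //; exact: cvgZr_tmp.
have zx : z t @[t --> (0 : R)^'] --> x.
  suff : z t @[t --> (0 : R)^'] --> x + 0 by rewrite addr0.
  by apply: cvgD => //; exact: cvg_cst.
(* Since [z t] moves with [t], the uniformity of [taylor_step] in the base point is essential. The
   tolerance [e / C] absorbs the constant in [|w_i|^k <= C |t|^k]. *)
have step : small k (fun t => L (g (z t + w t 0 i *: delta_mx 0 i))
    - (\poly_(n < k.+1) (L (iter n (partial i) g (z t)) / n`!%:R)).[w t 0 i]).
  have [C C0 wC] := dominated_gt0 _ _ (wK i k kK).
  move=> e e0; have eC : 0 < e / C by rewrite divr_gt0.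
  have [delta delta0 deltaP] :=
    taylor_step _ linL contL _ _ _ _ i Uopen gk Ux _ eC.
  near=> t; apply: (@le_trans _ _ (e / C * `|w t 0 i| ^+ k)).
    apply: deltaP; near: t; first by move/cvgr_dist_lt: zx; apply.
    by move/cvgr0_norm_lt: (w0 i); apply.
  have -> : e * `|t| ^+ k = e / C * (C * `|t| ^+ k) by field; rewrite gt_eqF.
  by rewrite ler_pM2l // -normrX; near: t.
(* The [n]-th coefficient is only of class [C^(k-n)], so its error is [o(t^(k-n))]; the factor
   [w_i^n = O(t^n)] restores the order [k]. *)
have rest : small k (fun t => \sum_(n < k.+1) n`!%:R^-1 * w t 0 i ^+ n *
    (L (iter n (partial i) g (z t))
     - taylor_part l (k - n) (iter n (partial i) g) t)).
  apply: small_sum => n _; have nk : (n <= k)%N by rewrite -ltnS.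
  rewrite -[k in small k](subnKC nk); apply: small_domM.
    rewrite -[X in dominated X]add0n; apply: dominatedM; first exact: dominated_cst.
    exact: wK (leq_trans nk kK).
  apply: IHl => //; first by rewrite (leq_trans (leq_subr _ _)).
  by apply: is_Ck_iter; rewrite subnKC.
apply: eq_small (smallD _ _ _ step rest) => t.
rewrite taylor_part_rcons // -cats1 big_cat big_seq1 addrA -/(z t).
under [X in _ + X]eq_bigr do rewrite mulrBr.
rewrite sumrB horner_poly addrA; congr (_ - _).
rewrite -addrA -[RHS]addr0; congr (_ + _).
apply/eqP; rewrite addrC subr_eq0; apply/eqP.
by apply: eq_bigr => n _; ring.
Unshelve. all: by end_near. Qed.

Lemma taylor_curve g : is_Ck K U g ->
  small K (fun t => L (g (x + w t)) -
    \sum_(alpha : bmultinom p K.+1)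
      L (mpartial alpha g x) * monomial (w t 0) alpha).
Proof.
move=> gK;
apply: eq_small (taylor_curve_seq _ _ _ (enum_uniq 'I_p) (leqnn K) gK) => t.
rewrite big_enum -row_sum_delta.
congr (_ - _); rewrite /taylor_part; apply: eq_big => // alpha.
rewrite -ltnS bmdeg; apply/supportedP => j.
by rewrite mem_enum.
Qed.

End TaylorCurve.

(** * Taylor polynomials and prolongations *)

Lemma partial_eq0 (R : realType) (W : normedModType R) (p : nat)
    (U : set 'rV[R]_p) (g : 'rV[R]_p -> W) (i : 'I_p) : open U ->
  (forall x, U x -> g x = 0) -> forall x, U x -> partial i g x = 0.
Proof.
move=> oU g0 x Ux; rewrite /partial (@near_eq_derive _ _ _ _ (cst 0)) ?derive_cst //.
by apply: filterS (open_nbhs_nbhs (conj oU Ux)) => y /g0.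
Qed.

Lemma mpartial_eq0 (R : realType) (W : normedModType R) (p : nat)
    (U : set 'rV[R]_p) (g : 'rV[R]_p -> W) (alpha : multinom p) : open U ->
  (forall x, U x -> g x = 0) -> forall x, U x -> mpartial alpha g x = 0.
Proof.
move=> oU g0; rewrite /mpartial; elim: (enum _) => //= i l IHl.
by elim: (alpha i) => //= n IHn; exact: partial_eq0.
Qed.

Lemma small_poly0 (R : realType) (k : nat) (q : {poly R}) :
  small k (fun t => q.[t]) -> q.[0] = 0.
Proof.
move=> qk; have q0 : q.[t] @[t --> (0 : R)^'] --> q.[0].
  by apply/continuous_withinNx; exact: continuous_horner.
have : q.[t] @[t --> (0 : R)^'] --> (0 : R).
  apply/cvgr0Pnorm_le => e e0; near=> t.
  apply: (@le_trans _ _ (e * `|t| ^+ k)); first by near: t; exact: qk.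
  have t1 : `|t| <= 1 by near: t; exact: dnbhs0_le.
  by rewrite ler_piMr ?exprn_ile1 // ltW.
exact: cvg_unique q0.
Unshelve. all: by end_near. Qed.

(** The limit at 0 kills the constant coefficient; dividing by [t] then lowers both the order and
    the degree. *)
Lemma small_poly (R : realType) (k : nat) (q : {poly R}) :
  small k (fun t => q.[t]) -> forall j, (j <= k)%N -> q`_j = 0.
Proof.
elim: k q => [|k IHk] q qk j.
  rewrite leqn0 => /eqP ->; rewrite -horner_coef0; exact: small_poly0 qk.
have := small_poly0 _ _ _ qk; elim/poly_ind: q qk => [|q c _] qk;
  first by rewrite coef0.
rewrite hornerMXaddC mulr0 add0r => c0; rewrite c0 addr0 in qk *.
rewrite coefMX; case: j => //= j jk; apply: IHk => // e e0; near=> t.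
have t0 : 0 < `|t| by rewrite normr_gt0; near: t; exact: nbhs_dnbhs_neq.
rewrite -(ler_pM2r t0) -normrM -mulrA -exprSr -hornerMX.
by near: t; exact: qk.
Unshelve. all: by end_near. Qed.

Lemma mpartial0 (R : realType) (W : normedModType R) (p : nat)
    (f : 'rV[R]_p -> W) : mpartial mnm0 f = f.
Proof.
by rewrite /mpartial; elim: (enum _) => //= i l ->; rewrite mnm0E.
Qed.

Section TaylorPolynomials.
Context {R : realType} {N p : nat}.
Implicit Types (D : multinom p -> R).

(** Kept as a formal polynomial so that both real increments and nilpotent elements of [A] can be
    substituted in it. *)
Definition taylor_poly D : mpoly p R :=
  \sum_(alpha : bmultinom p N.+1)
    ((mfactorial alpha)%:R^-1 * D alpha) *: mpolyX R alpha.

Lemma meval_taylor_poly D h :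
  meval h (taylor_poly D) =
  \sum_(alpha : bmultinom p N.+1) D alpha * monomial h alpha.
Proof.
rewrite raddf_sum; apply: eq_bigr => alpha _.
by rewrite /= mevalZ mevalX /monomial mulrAC mulrC.
Qed.

Lemma mmap_taylor_poly (A : weilAlgType R N) D (H : 'rV[A]_p) :
  mmap (GRing.in_alg A) (H 0) (taylor_poly D) = taylor_sum D H.
Proof.
rewrite raddf_sum; apply: eq_bigr => alpha _.
by rewrite /= mmapZ mmapX mulr_algl.
Qed.

(** Every term of positive degree has a factor in the maximal ideal. Hence the prolongation of [f]
    at [X] lies over the point [f(x)]. *)
Lemma scalar_part_taylor_sum (A : weilAlgType R N) D (H : 'rV[A]_p) :
  (forall i, H 0 i \in (weil_ideal : {vspace A})) ->
  scalar_part (taylor_sum D H) = D mnm0.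
Proof.
move=> Hm; apply: scalar_part_unique.
rewrite /taylor_sum (bigD1 (BMultinom (bm0_proof p N))) //=.
have -> : mfactorial (mnm0 : multinom p) = 1%N.
  by rewrite /mfactorial big1 // => i _; rewrite mnm0E.
rewrite invr1 mul1r [\prod_(i < p) _]mmap11 addrAC subrr add0r.
apply: memv_suml => alpha; rewrite -val_eqE /= => alpha0.
have [i ai] : exists i, alpha i != 0%N.
  apply/forallPn; apply: contra alpha0 => /forallP alpha0.
  by apply/eqP/mnmP => i; rewrite mnm0E; apply/eqP.
apply: memvZ; rewrite (bigD1 i) //= mulrC; apply: weil_idealM.
by move: ai; case: (alpha i) => // n _; rewrite exprSr; apply: weil_idealM.
Qed.

Lemma mmap_taylor_sum_eq0 (A : weilAlgType R N) s (D : 'I_s -> multinom p -> R)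
    (G : mpoly s R) (H : 'rV[A]_p) :
  (forall v : 'rV[R]_p,
     small N (fun t =>
       meval (fun i => meval ((t *: v) 0) (taylor_poly (D i))) G)) ->
  (forall i, H 0 i \in (weil_ideal : {vspace A})) ->
  mmap (GRing.in_alg A) (fun i => taylor_sum (D i) H) G = 0.
Proof.
move=> GD Hm; pose Q := mmap (@mpolyC p R) (fun i => taylor_poly (D i)) G.
have -> : mmap (GRing.in_alg A) (fun i => taylor_sum (D i) H) G
    = mmap (GRing.in_alg A) (H 0) Q.
  rewrite rmorph_mmap; apply: eq_mmap => [c|i] /=; first by rewrite mmapC.
  by rewrite mmap_taylor_poly.
(* Terms of degree above [N] die by nilpotency; the others have zero coefficients because [Q(t v)]
   is [o(t^N)] for every [v]. *)
apply: mmap_nilpotent_eq0 => // alpha aN.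
apply: (mcoeff_eq0_line (mdeg alpha)) => // v.
apply: (@small_poly _ N) => //; apply: eq_small (GD (\row_j v j)) => t.
rewrite horner_mmap /Q /meval rmorph_mmap; apply: eq_mmap => [c|i] /=.
  by rewrite mmapC.
by apply: eq_mmap => // j; rewrite !mxE hornerM hornerC hornerX mulrC.
Qed.

Lemma mmap1_scale (t : R) (v : 'rV[R]_p) (alpha : multinom p) :
  mmap1 ((t *: v) 0) alpha = t ^+ mdeg alpha * mmap1 (v 0) alpha.
Proof.
rewrite mdegE -prodrXr -big_split /=; apply: eq_bigr => i _.
by rewrite mxE exprMn.
Qed.

Context {W : normedModType R} (L : W -> R).
Hypothesis linL : forall a u v, L (a *: u + v) = a * L u + L v.
Hypothesis contL : continuous L.
Context (U : set 'rV[R]_p) (Uopen : open U) (f : 'rV[R]_p -> W).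
Hypothesis fN : is_Ck N U f.
Context (x : 'rV[R]_p) (Ux : U x) (v : 'rV[R]_p).

Lemma cvg_line : x + t *: v @[t --> (0 : R)^'] --> x.
Proof.
suff : x + t *: v @[t --> (0 : R)^'] --> x + 0 *: v by rewrite scale0r addr0.
apply: cvgD; first exact: cvg_cst.
by apply: cvgZr_tmp; exact: nbhs_dnbhs.
Qed.

Lemma near_line_in : \forall t \near (0 : R)^', U (x + t *: v).
Proof. exact: cvg_line (open_nbhs_nbhs (conj Uopen Ux)). Qed.

Lemma cvg_line_comp : L (f (x + t *: v)) @[t --> (0 : R)^'] --> L (f x).
Proof.
apply: (continuous_cvg _ (contL _)).
exact: (continuous_cvg _ (is_Ck_continuous _ _ _ _ fN Ux) cvg_line).
Qed.

Lemma taylor_line : small N (fun t => L (f (x + t *: v)) -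
  meval ((t *: v) 0) (taylor_poly (fun alpha => L (mpartial alpha f x)))).
Proof.
have lin1 j n : dominated n (fun t => (t *: v) 0 j ^+ n).
  exists (`|v 0 j| ^+ n); near=> t.
  by rewrite mxE normrX normrM exprMn mulrC.
have w0 j : (t *: v) 0 j @[t --> (0 : R)^'] --> (0 : R).
  have -> : (fun t : R => (t *: v) 0 j) = (fun t => t * v 0 j).
    by apply/funext => t; rewrite mxE.
  suff : t * v 0 j @[t --> (0 : R)^'] --> 0 * v 0 j by rewrite mul0r.
  by apply: cvgM; [exact: nbhs_dnbhs|exact: cvg_cst].
apply: eq_small (taylor_curve _ linL contL _ Uopen N _ Ux _ w0
  (fun j n _ => lin1 j n) _ fN) => t.
by rewrite meval_taylor_poly.
Unshelve. all: by end_near. Qed.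

(** Supplies the hypothesis [wK] of [taylor_curve] for the increments of [f] along a line. If
    [n > 0] then [N > 0], and the Taylor formula without its constant term is [O(t)]. *)
Lemma dominated_increment n : (n <= N)%N ->
  dominated n (fun t => (L (f (x + t *: v)) - L (f x)) ^+ n).
Proof.
case: n => [|n] nN; first exact: dominated_cst.
suff : dominated 1 (fun t => L (f (x + t *: v)) - L (f x)).
  by move=> /(dominatedX _ n.+1); rewrite mul1n.
have tl := dominated_leq 1 _ _ (leq_ltn_trans (leq0n n) nN)
  (small_dominated _ _ taylor_line).
pose rest t :=
  \sum_(alpha : bmultinom p N.+1 | alpha != BMultinom (bm0_proof p N))
   L (mpartial alpha f x) * monomial ((t *: v) 0) alpha.
have restD : dominated 1 rest.
  apply: dominated_sum => alpha alpha0.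
  have a1 : (1 <= mdeg alpha)%N by rewrite lt0n mdeg_eq0.
  apply: dominated_leq a1 _.
  exists `|L (mpartial alpha f x) * monomial (v 0) alpha|; near=> t.
  rewrite /monomial mmap1_scale -normrX -normrM le_eqVlt; apply/orP; left.
  by apply/eqP; congr `|_|; ring.
apply: eq_dominated (dominatedD _ _ _ tl restD) => t.
rewrite meval_taylor_poly (bigD1 (BMultinom (bm0_proof p N))) //=.
by rewrite monomial0 mulr1 mpartial0 /rest opprD addrA subrK.
Unshelve. all: by end_near. Qed.

End TaylorPolynomials.
Arguments taylor_poly {R} N {p} D.

(** * Polynomial relations between prolongations *)

Lemma nil_parts_mem (R : realType) N (A : weilAlgType R N) p (X : 'rV[A]_p) i :
  nil_parts X 0 i \in (weil_ideal : {vspace A}).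
Proof. by rewrite mxE scalar_part_split. Qed.

(** The families [W], [L] and [f] cover both statements: [s] real functions with [L i] the identity,
    or one map to [R^s] with [L i] its [i]-th coordinate. *)
Lemma mmap_prolong_eq0 (R : realType) N (A : weilAlgType R N) p s
    (W : 'I_s -> normedModType R) (L : forall i, W i -> R)
    (U : set 'rV[R]_p) (f : forall i, 'rV[R]_p -> W i) x (G : mpoly s R)
    (H : 'rV[A]_p) :
  (forall i a u v, L i (a *: u + v) = a * L i u + L i v) ->
  (forall i, continuous (L i)) -> open U -> (forall i, is_Ck N U (f i)) -> U x ->
  (forall v, small N (fun t => meval (fun i => L i (f i (x + t *: v))) G)) ->
  (forall i, H 0 i \in (weil_ideal : {vspace A})) ->
  mmap (GRing.in_alg A)
    (fun i => taylor_sum (fun alpha => L i (mpartial alpha (f i) x)) H) G = 0.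
Proof.
move=> linL contL oU fN Ux GF; apply: mmap_taylor_sum_eq0 => v.
have F0 i : dominated 0 (fun t => L i (f i (x + t *: v))).
  exact: cvg_dominated (cvg_line_comp _ (contL i) _ _ (fN i) _ Ux v).
have FT i := taylor_line _ (linL i) (contL i) _ oU _ (fN i) _ Ux v.
pose T i t := meval ((t *: v) 0)
  (taylor_poly N (fun alpha => L i (mpartial alpha (f i) x))).
have T0 i : dominated 0 (T i).
  have dom := dominatedD _ _ _ (F0 i)
    (dominated_leq 0 _ _ (leq0n N) (small_dominated _ _ (smallN _ _ (FT i)))).
  by apply: eq_dominated dom => t; rewrite /T; ring.
(* Replacing the functions by their Taylor polynomials [T i] changes [G] by [o(t^N)] only. *)
have := smallD _ _ _ (smallN _ _ (small_meval N s G _ _ F0 T0 FT)) (GF v).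
by apply: eq_small => t; rewrite /T; ring.
Qed.

Theorem corollary4p2 (R : realType) (N : nat) (A : weilAlgType R N)
    (p s r : nat) (U : set 'rV[R]_p) (Uopen : open U) :
  (forall (P : 'I_r -> mpoly s R) (f : 'I_s -> 'rV[R]_p -> R),
     (forall i, is_Ck N U (f i)) ->
     (forall x, U x -> forall k, meval (fun i => f i x) (P k) = 0) ->
     forall X : 'rV[A]_p, prolong_set U X ->
       polymap_eval P (\row_i prolong (f i) X) = 0)
  /\
  (forall (f : 'rV[R]_p -> 'rV[R]_s) (V : set 'rV[R]_s)
          (h : 'rV[R]_s -> 'rV[R]_r),
     is_Ck N U f -> open V -> f @` U `<=` V -> is_Ck N V h ->
     (forall x, U x -> h (f x) = 0) ->
     forall X : 'rV[A]_p, prolong_set U X ->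
       prolong_row h (prolong_row f X) = prolong_row (h \o f) X
       /\ prolong_row (h \o f) X = 0).
Proof.
split=> [P f fN Pf X UX|f V h fN oV fUV hN hf X UX]; set x := scalar_parts X in UX.
  apply/rowP => k; rewrite !mxE.
  have -> : mmap (GRing.in_alg A) (fun i => (\row_i prolong (f i) X) 0 i) (P k)
      = mmap (GRing.in_alg A) (fun i => prolong (f i) X) (P k).
    by apply: eq_mmap => // i; rewrite mxE.
  apply: (mmap_prolong_eq0 _ _ _ _ _ (fun=> R) (fun _ => id) U f x) => //.
  - by move=> i u; exact: cvg_id.
  - move=> v e e0; near=> t; rewrite Pf ?normr0.
      by rewrite mulr_ge0 ?exprn_ge0 // ltW.
    by near: t; exact: near_line_in.
  exact: nil_parts_mem.
have hfX : prolong_row (h \o f) X = 0 :> 'rV[A]_r.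
  apply/rowP => k; rewrite !mxE /taylor_sum big1 // => alpha _.
  by rewrite (mpartial_eq0 _ _ _ U) // mxE mulr0 scale0r.
split=> //; rewrite hfX; apply/rowP => k; rewrite !mxE.
have Ux : U x by [].
have Vy : V (f x) by apply: fUV; exists x.
pose D (i : 'I_s) alpha := mpartial alpha f x 0 i.
have yE : scalar_parts (prolong_row f X) = f x.
  apply/rowP => i; rewrite !mxE scalar_part_taylor_sum ?mpartial0 //.
  by move=> j; exact: nil_parts_mem.
rewrite yE -mmap_taylor_poly.
pose E alpha := mpartial alpha h (f x) 0 k.
(* The Taylor polynomial of the [k]-th component of [h], recentred at [f(x)]: substituting the
   prolonged coordinates of [f] in [G] amounts to substituting their nilpotent parts in
   [taylor_poly N E]. *)
pose G := mmap (@mpolyC s R) (fun i => mpolyX R (mnm1 i) - mpolyC s (f x 0 i))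
  (taylor_poly N E).
have -> : mmap (GRing.in_alg A) (nil_parts (prolong_row f X) 0) (taylor_poly N E)
    = mmap (GRing.in_alg A) (fun i => taylor_sum (D i) (nil_parts X)) G.
  rewrite rmorph_mmap; apply: eq_mmap => [c|i] /=; first by rewrite mmapC.
  rewrite mxE mmapB mmapX mmap1U mmapC !mxE -/(D i); congr (_ - (_)%:A).
  rewrite scalar_part_taylor_sum => [|j]; last exact: nil_parts_mem.
  by rewrite /D mpartial0.
pose L n (i : 'I_n) (u : 'rV[R]_n) := u 0 i.
have linL n i a u v : L n i (a *: u + v) = a * L n i u + L n i v by rewrite /L !mxE.
have contL n i : continuous (L n i) by exact: coord_continuous.
apply: (mmap_prolong_eq0 _ _ _ _ _ (fun=> 'rV[R]_s) (L s) U (fun=> f) x) => //;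
  [exact: contL| |exact: nil_parts_mem].
move=> v; pose w t := f (x + t *: v) - f x.
have w0 j : w t 0 j @[t --> (0 : R)^'] --> (0 : R).
  suff : L s j (f (x + t *: v)) - f x 0 j @[t --> (0 : R)^']
      --> f x 0 j - f x 0 j.
    have -> : (fun t => L s j (f (x + t *: v)) - f x 0 j) = (fun t => w t 0 j).
      by apply/funext => t; rewrite !mxE.
    by rewrite subrr.
  apply: cvgB; last exact: cvg_cst.
  exact: cvg_line_comp _ (contL s j) _ _ fN _ Ux v.
have wN j n : (n <= N)%N -> dominated n (fun t => w t 0 j ^+ n).
  move=> nN; apply: eq_dominated (dominated_increment _ (linL s j) (contL s j)
    _ Uopen _ fN _ Ux v _ nN) => t.
  by rewrite /w /L !mxE.
(* Taylor expansion of [h] at [f(x)] along the curve [w]. As [h] vanishes at [f(x + t v)], the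
   remainder is minus the value of [G] at [f(x + t v)], which is therefore [o(t^N)]. *)
have := taylor_curve _ (linL r k) (contL r k) _ oV N _ Vy w w0 wN _ hN.
move=> /small_le; apply; near=> t.
have Uxt : U (x + t *: v) by near: t; exact: near_line_in.
rewrite [f x + _]addrC subrK hf // /L mxE sub0r normrN.
rewrite -(meval_taylor_poly E) le_eqVlt; apply/orP; left; apply/eqP.
congr `|_|; rewrite /G /meval rmorph_mmap; apply: eq_mmap => [c|i] /=.
  by rewrite mmapC.
by rewrite mmapB mmapX mmap1U mmapC !mxE.
Unshelve. all: by end_near. Qed.
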